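(* Let $u:\mathbb{H}^1\to\mathbb{R}$ be given by $u(x,y,t)=x-3yt-2x^3$. Then $\Delta_{\mathbb{H}^1}u=0$, and the function $$J_u^{\mathbb{H}^1}(r)=\frac{1}{r^4}\left(\int_{B_r^{\mathbb{H}^1}(0)}\frac{|\nabla_{\mathbb{H}^1}u^+(\xi)|^2}{|\xi|_{\mathbb{H}^1}^2}\,d\xi\right)\left(\int_{B_r^{\mathbb{H}^1}(0)}\frac{|\nabla_{\mathbb{H}^1}u^-(\xi)|^2}{|\xi|_{\mathbb{H}^1}^2}\,d\xi\right),\qquad r>0,$$ is strictly monotone decreasing in a right neighborhood of $r=0$, i.e. there is $r_0>0$ such that $J_u^{\mathbb{H}^1}$ is strictly decreasing on $(0,r_0)$.
   Context: $\mathbb{H}^1$ is the first Heisenberg group: $\mathbb{R}^3$ with points $\xi=(x,y,t)$ and group law $(x_1,y_1,t_1)\circ(x_2,y_2,t_2)=(x_1+x_2,y_1+y_2,t_1+t_2+2(x_2y_1-x_1y_2))$. The vector fields are $X=\partial_x+2y\,\partial_t$ and $Y=\partial_y-2x\,\partial_t$; the horizontal gradient is $\nabla_{\mathbb{H}^1}u=(Xu,Yu)$ with $|\nabla_{\mathbb{H}^1}u|^2=(Xu)^2+(Yu)^2$; the Kohn-Laplace operator is $\Delta_{\mathbb{H}^1}=X^2+Y^2$. The Koranyi norm is $|(x,y,t)|_{\mathbb{H}^1}=((x^2+y^2)^2+t^2)^{1/4}$ and $B_r^{\mathbb{H}^1}(0)=\{\xi:|\xi|_{\mathbb{H}^1}<r\}$.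 $d\xi$ is Lebesgue measure on $\mathbb{R}^3$. $u^+=\sup\{u,0\}$ and $u^-=\sup\{-u,0\}$; their horizontal gradients are understood almost everywhere. *)

(* Defs.v *)
From mathcomp Require Import all_boot all_order all_algebra.
From mathcomp Require Import all_classical all_reals all_analysis.

Set Implicit Arguments.
Unset Strict Implicit.
Unset Printing Implicit Defensive.

Import Order.TTheory GRing.Theory Num.Theory.
Import numFieldNormedType.Exports.

Local Open Scope classical_set_scope.
Local Open Scope ring_scope.

(* Points of H^1 are written ((x, y), t). The group law
     (x1,y1,t1) o (x2,y2,t2) = (x1+x2, y1+y2, t1+t2+2(x2*y1-x1*y2))
   enters only through its left-invariant vector fields X and Y.           *)

Section Heisenberg.
Context {R : realType}.

Local Notation heis := (R * R * R)%type.

(* 'D_v f is total. For f = u^\+ or u^\- with u smooth, the partial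
   derivatives exist off a Lebesgue-null subset of {u = 0}, so the
   conventional value taken where they do not exist does not affect the
   integrals below.                                                        *)
Definition partial_x (f : heis -> R) (p : heis) : R :=
  'D_((1, 0, 0) : heis) f p.
Definition partial_y (f : heis -> R) (p : heis) : R :=
  'D_((0, 1, 0) : heis) f p.
Definition partial_t (f : heis -> R) (p : heis) : R :=
  'D_((0, 0, 1) : heis) f p.

Definition heisX (f : heis -> R) (p : heis) : R :=
  let: (x, y, t) := p in partial_x f p + 2 * y * partial_t f p.
Definition heisY (f : heis -> R) (p : heis) : R :=
  let: (x, y, t) := p in partial_y f p - 2 * x * partial_t f p.

Definition hgrad (f : heis -> R) (p : heis) : R * R :=
  (heisX f p, heisY f p).

(* The Euclidean norm squared: the library norm on R * R is the sup norm. *)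
Definition sqnorm2 (v : R * R) : R := v.1 ^+ 2 + v.2 ^+ 2.

Definition kohn_laplace (f : heis -> R) (p : heis) : R :=
  heisX (heisX f) p + heisY (heisY f) p.

Definition koranyi (p : heis) : R :=
  let: (x, y, t) := p in ((x ^+ 2 + y ^+ 2) ^+ 2 + t ^+ 2) `^ (4^-1).

Definition koranyi_ball (r : R) : set heis := [set p | koranyi p < r].

Definition lebesgue3 :=
  ((@lebesgue_measure R \x @lebesgue_measure R) \x @lebesgue_measure R)%E.

Definition weighted_energy (f : heis -> R) (r : R) : \bar R :=
  (\int[lebesgue3]_(p in koranyi_ball r)
     (sqnorm2 (hgrad f p) / koranyi p ^+ 2)%:E)%E.

(* Extended-real valued, so that a divergent integral is not silently
   replaced by a real number.                                              *)
Definition heisJ (u : heis -> R) (r : R) : \bar R :=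
  (((r ^+ 4)^-1)%:E * weighted_energy (u^\+)%R r
                    * weighted_energy (u^\-)%R r)%E.

Definition u_ex (p : heis) : R :=
  let: (x, y, t) := p in x - 3 * y * t - 2 * x ^+ 3.

End Heisenberg.

(* Main.v *)
(* u is odd under (x,y,t) |-> (-x,-y,t), a symmetry that preserves Lebesgue
   measure, the Koranyi norm and |grad u|^2; as {u = 0} is a null set, the
   energies of u^+ and u^- both equal half the energy of u on the ball. The
   dilations (x,y,t) |-> (rx,ry,r^2 t) have Jacobian r^4, so the energy of u on
   the ball of radius r is r^2 m(r), where, with rho^2 = x^2 + y^2,
     m(r) = int_{B_1} ((1 - 6 r^2 rho^2)^2 + r^4 (6xy - 3t)^2) / |xi|^2 dxi
          = a - 12 b r^2 + c r^4
   and b = int_{B_1} rho^2 / |xi|^2 > 0. Hence J(r) = m(r)^2 / 4, which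
   decreases for small r. *)
From HB Require Import structures.
Require Import Defs.
From mathcomp Require Import all_boot all_order all_algebra.
From mathcomp Require Import all_classical all_reals all_analysis.
From mathcomp Require Import measurable_realfun ring lra.
Import Order.TTheory GRing.Theory Num.Theory.
Import numFieldNormedType.Exports.
Set Implicit Arguments.
Unset Strict Implicit.
Local Open Scope ring_scope.

(** * Derivatives of the positive part *)

Section Derivatives.
Context {R : realType} {V : normedModType R}.

(** The two difference quotients agree for every [h], so derivability and the derivative along [v]
    reduce to one real variable, whatever the regularity of [f]. *)
Lemma growth_rate_line (f : V -> R) (p v : V) :
  (fun h : R => h^-1 *: ((f \o shift p) (h *: v) - f p)) =
  (fun h : R => h^-1 *: (((fun s : R => f (s *: v + p)) \o shift 0) (h *: 1)
     - f (0 *: v + p))).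
Proof.
apply/funext => h /=.
by rewrite scale0r add0r addr0 [h *: 1]mulr1.
Qed.

Lemma derive_line (f : V -> R) (p v : V) :
  'D_v f p = 'D_1 (fun s : R => f (s *: v + p)) 0.
Proof. by rewrite /derive growth_rate_line. Qed.

Lemma is_derive_line (f : V -> R) (p v : V) (d : R) :
  is_derive (0 : R) 1 (fun s : R => f (s *: v + p)) d <-> is_derive p v f d.
Proof.
split=> -[df <-]; split.
- by rewrite /derivable growth_rate_line.
- exact: derive_line.
- by move: df; rewrite /derivable growth_rate_line.
- exact/esym/derive_line.
Qed.

(* If f is not derivable along v at p, the derivative is the default value 0. *)
Lemma derive_ge0_eq0 (f : V -> R) (p v : V) :
  (forall q, 0 <= f q) -> f p = 0 -> 'D_v f p = 0.
Proof.
move=> f0 fp.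
have [df|df] := pselect (derivable f p v); last first.
  by rewrite /derive; apply: dvgP.
have /cvg_ex[l fl] := df.
have -> : 'D_v f p = l by exact: cvg_lim fl.
(* [f] is minimal at [p]: the difference quotients are at most 0 from the left and at least 0 from
   the right, so their limit is 0. *)
apply/eqP; rewrite eq_le; apply/andP; split.
  apply: (cvgr_to_le (cvg_dnbhs_at_left fl)); near=> h => /=.
  by rewrite fp subr0 mulr_le0_ge0// invr_le0.
apply: (cvgr_to_ge (cvg_dnbhs_at_right fl)); near=> h => /=.
by rewrite fp subr0 mulr_ge0// invr_ge0.
Unshelve. all: by end_near. Qed.

(** If [f p] is nonzero, continuity along the line keeps the sign of [f] near [p]; if [f p = 0], the
    positive part is minimal at [p]. The formula thus holds at every point, the zero set
    included. *)
Lemma derive_funrpos (f : V -> R) (p v : V) (d : R) : is_derive p v f d ->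
  'D_v (f^\+) p = if 0 < f p then d else 0.
Proof.
move=> dfp; have [fp|fp|fp] := ltgtP 0 (f p); last first.
- by apply: derive_ge0_eq0 => [q|]; rewrite ?funrpos_ge0// /funrpos -fp maxxx.
- have /is_derive_line[+ _] := dfp.
  move=> /derivable1_diffP/differentiable_continuous ct.
  rewrite derive_line -(@near_eq_derive _ _ _ (cst 0)) ?derive_cst//.
  have : \forall s \near (0 : R), f (s *: v + p) < 0.
    by apply: (cvgr_lt _ ct); rewrite scale0r add0r.
  by apply: filterS => s /ltW fs; rewrite /funrpos max_r.
- have /is_derive_line[+ _] := dfp.
  move=> /derivable1_diffP/differentiable_continuous ct.
  rewrite derive_line -(@near_eq_derive _ _ _ (fun s : R => f (s *: v + p))).
    by rewrite -derive_line; have [_] := dfp.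
  have : \forall s \near (0 : R), 0 < f (s *: v + p).
    by apply: (cvgr_gt _ ct); rewrite scale0r add0r.
  by apply: filterS => s /ltW fs; rewrite /funrpos max_l.
Qed.

End Derivatives.

(** * Harmonicity of u, and the horizontal gradients of its two parts *)

Section Example.
Context {R : realType}.
Local Notation heis := (R * R * R)%type.
Implicit Types x y t : R.

Lemma line_x x y t (s : R) :
  s *: ((1, 0, 0) : heis) + (x, y, t) = (s + x, y, t).
Proof. by congr (_, _, _); rewrite /= ?scaler0 ?add0r// [_ *: 1]mulr1. Qed.

Lemma line_y x y t (s : R) :
  s *: ((0, 1, 0) : heis) + (x, y, t) = (x, s + y, t).
Proof. by congr (_, _, _); rewrite /= ?scaler0 ?add0r// [_ *: 1]mulr1. Qed.

Lemma line_t x y t (s : R) :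
  s *: ((0, 0, 1) : heis) + (x, y, t) = (x, y, s + t).
Proof. by congr (_, _, _); rewrite /= ?scaler0 ?add0r// [_ *: 1]mulr1. Qed.

Lemma is_derive_x_u_ex x y t :
  is_derive ((x, y, t) : heis) ((1, 0, 0) : heis) u_ex (1 - 6 * x ^+ 2).
Proof.
apply/is_derive_line; rewrite [X in is_derive _ _ X](_ : _ =
  fun s => s + x - 3 * y * t - 2 * (s + x) ^+ 3); last first.
  by apply/funext => s; rewrite line_x.
by apply: is_derive_eq; rewrite /GRing.scale/=; ring.
Qed.

Lemma is_derive_y_u_ex x y t :
  is_derive ((x, y, t) : heis) ((0, 1, 0) : heis) u_ex (- 3 * t).
Proof.
apply/is_derive_line; rewrite [X in is_derive _ _ X](_ : _ =
  fun s => x - 3 * (s + y) * t - 2 * x ^+ 3); last first.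
  by apply/funext => s; rewrite line_y.
by apply: is_derive_eq; rewrite /GRing.scale/=; ring.
Qed.

Lemma is_derive_t_u_ex x y t :
  is_derive ((x, y, t) : heis) ((0, 0, 1) : heis) u_ex (- 3 * y).
Proof.
apply/is_derive_line; rewrite [X in is_derive _ _ X](_ : _ =
  fun s => x - 3 * y * (s + t) - 2 * x ^+ 3); last first.
  by apply/funext => s; rewrite line_t.
by apply: is_derive_eq; rewrite /GRing.scale/=; ring.
Qed.

Definition Xu (p : heis) : R := 1 - 6 * (p.1.1 ^+ 2 + p.1.2 ^+ 2).
Definition Yu (p : heis) : R := 6 * p.1.1 * p.1.2 - 3 * p.2.

Lemma heisX_u_ex : heisX u_ex = Xu.
Proof.
apply/funext => -[[x y] t]; rewrite /heisX /partial_x /partial_t /Xu.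
have [_ ->] := is_derive_x_u_ex x y t; have [_ ->] := is_derive_t_u_ex x y t.
by rewrite /=; ring.
Qed.

Lemma heisY_u_ex : heisY u_ex = Yu.
Proof.
apply/funext => -[[x y] t]; rewrite /heisY /partial_y /partial_t /Yu.
have [_ ->] := is_derive_y_u_ex x y t; have [_ ->] := is_derive_t_u_ex x y t.
by rewrite /=; ring.
Qed.

(** As [Xu] does not depend on t, X X u = -12 x, while Y Y u = 6 x - 2 x (-3) = 12 x. *)
Lemma kohn_laplace_u_ex (p : heis) : kohn_laplace u_ex p = 0.
Proof.
rewrite /kohn_laplace heisX_u_ex heisY_u_ex; case: p => [[x y] t].
have dxX : is_derive ((x, y, t) : heis) ((1, 0, 0) : heis) Xu (- 12 * x).
  apply/is_derive_line; under eq_fun do rewrite line_x /Xu/=.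
  by apply: is_derive_eq; rewrite /GRing.scale/=; ring.
have dtX : is_derive ((x, y, t) : heis) ((0, 0, 1) : heis) Xu 0.
  apply/is_derive_line; under eq_fun do rewrite line_t /Xu/=.
  exact: is_derive_cst.
have dyY : is_derive ((x, y, t) : heis) ((0, 1, 0) : heis) Yu (6 * x).
  apply/is_derive_line; under eq_fun do rewrite line_y /Yu/=.
  by apply: is_derive_eq; rewrite /GRing.scale/=; ring.
have dtY : is_derive ((x, y, t) : heis) ((0, 0, 1) : heis) Yu (- 3).
  apply/is_derive_line; under eq_fun do rewrite line_t /Yu/=.
  by apply: is_derive_eq; rewrite /GRing.scale/=; ring.
rewrite /heisX /heisY /partial_x /partial_y /partial_t.
by rewrite !(@derive_val _ _ _ _ _ _ _ _); ring.
Qed.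

(** All three partial derivatives switch on the same condition [0 < u_ex p], hence so do both
    components of the gradient. *)
Lemma hgrad_u_ex_pos (p : heis) :
  hgrad (u_ex^\+) p = if 0 < u_ex p then (Xu p, Yu p) else (0, 0).
Proof.
rewrite -heisX_u_ex -heisY_u_ex; case: p => [[x y] t].
rewrite /hgrad /heisX /heisY /partial_x /partial_y /partial_t.
rewrite (derive_funrpos (is_derive_x_u_ex _ _ _)).
rewrite (derive_funrpos (is_derive_y_u_ex _ _ _)).
rewrite (derive_funrpos (is_derive_t_u_ex _ _ _)).
have [_ ->] := is_derive_x_u_ex x y t; have [_ ->] := is_derive_t_u_ex x y t.
have [_ ->] := is_derive_y_u_ex x y t.
by case: ifP => // _; rewrite !mulr0 addr0 subr0.
Qed.

Lemma hgrad_u_ex_neg (p : heis) :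
  hgrad (u_ex^\-) p = if u_ex p < 0 then (- Xu p, - Yu p) else (0, 0).
Proof.
rewrite -heisX_u_ex -heisY_u_ex; case: p => [[x y] t].
rewrite /hgrad /heisX /heisY /partial_x /partial_y /partial_t -funrposN.
have dN (v : heis) (d : R) : is_derive ((x, y, t) : heis) v u_ex d ->
    'D_v ((\- u_ex)^\+) (x, y, t) = if u_ex (x, y, t) < 0 then - d else 0.
  by move=> du; rewrite (derive_funrpos (is_deriveN du)) oppr_gt0.
rewrite (dN _ _ (is_derive_x_u_ex _ _ _)) (dN _ _ (is_derive_y_u_ex _ _ _)).
rewrite (dN _ _ (is_derive_t_u_ex _ _ _)).
have [_ ->] := is_derive_x_u_ex x y t; have [_ ->] := is_derive_t_u_ex x y t.
have [_ ->] := is_derive_y_u_ex x y t.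
by case: ifP => // _; congr (_, _); ring.
Qed.

Definition gradsq (p : heis) : R := Xu p ^+ 2 + Yu p ^+ 2.

Lemma sqnorm2_hgrad_pos p :
  sqnorm2 (hgrad (u_ex^\+) p) = if 0 < u_ex p then gradsq p else 0.
Proof.
by rewrite hgrad_u_ex_pos; case: ifP => // _; rewrite /sqnorm2/= expr0n addr0.
Qed.

Lemma sqnorm2_hgrad_neg p :
  sqnorm2 (hgrad (u_ex^\-) p) = if u_ex p < 0 then gradsq p else 0.
Proof.
rewrite hgrad_u_ex_neg; case: ifP => // _; rewrite /sqnorm2/= ?sqrrN//.
by rewrite expr0n addr0.
Qed.

End Example.

(** * Dilations and Lebesgue measure *)

Local Open Scope classical_set_scope.
Local Open Scope ereal_scope.

Section PlaneMeasure.
Context {R : realType}.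
Local Notation mu := (@lebesgue_measure R).
Local Notation T := (measurableTypeR R).

(* A named copy: the library's instances make m1 \x m2 sigma-finite only when
   m1 and m2 are subprobabilities. *)
Definition lebesgue2 := (mu \x mu).

HB.instance Definition _ := Measure.on lebesgue2.

Lemma sigma_finite_lebesgue2 : sigma_finite setT lebesgue2.
Proof.
have /sigma_finiteP[F [FT ndF Ffin]] := sigma_finiteT mu.
have Fm (x : R) (m n : nat) : (m <= n)%N -> F m x -> F n x.
  by move=> mn; exact/subsetPset/ndF.
exists (fun n => F n `*` F n).
- apply/esym/seteqP; split => // -[x y] _.
  have /= : (\bigcup_n F n) x by rewrite -FT.
  have /= : (\bigcup_n F n) y by rewrite -FT.
  (* The exhaustion is nondecreasing, so the larger index serves both coordinates. *)
  move=> [m _ Fy] [n _ Fx]; exists (maxn m n) => //; split => /=.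
    exact: Fm (leq_maxr _ _) Fx.
  exact: Fm (leq_maxl _ _) Fy.
- move=> n; have [mF muF] := Ffin n; split; first exact: measurableX.
  rewrite /lebesgue2 product_measure1E//.
  by apply: lte_mul_pinfty => //; rewrite ge0_fin_numE.
Qed.

HB.instance Definition _ :=
  Measure_isSigmaFinite.Build _ _ _ lebesgue2 sigma_finite_lebesgue2.

HB.instance Definition _ := Measure.on (@lebesgue3 R).

End PlaneMeasure.

Section LebesgueScaling.
Context {R : realType}.
Local Notation mu := (@lebesgue_measure R).
Local Notation T := (measurableTypeR R).

Lemma preimage_scale_ocitv (c a b : R) : (c != 0)%R ->
  (fun x : R => c * x)%R @^-1` `]a, b]%classic =
  if (0 < c)%R then `](c^-1 * a)%R, (c^-1 * b)%R]%classic
  else `[(c^-1 * b)%R, (c^-1 * a)%R[%classic.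
Proof.
move=> c0; case: ifPn => [cp|cn]; apply/seteqP; split => x /=;
  rewrite !in_itv/=.
- by rewrite ltr_pdivrMl// ler_pdivlMl.
- by rewrite ltr_pdivrMl// ler_pdivlMl.
- have {}cn : (c < 0)%R by rewrite lt_neqAle c0 leNgt.
  by rewrite ltr_ndivlMl// ler_ndivrMl// andbC.
- have {}cn : (c < 0)%R by rewrite lt_neqAle c0 leNgt.
  by rewrite ltr_ndivlMl// ler_ndivrMl// andbC.
Qed.

Lemma measurable_scale (c : R) :
  measurable_fun [set: T] (fun x : T => (c * x)%R : T).
Proof. exact: measurable_funM. Qed.

(** The measure [|c|] times the image of [mu] under multiplication by [c] gives each interval ]a, b]
    its length, so it is [mu] by uniqueness. A negative [c] swaps the open and closed ends of the
    preimage, which does not change its length. *)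
Lemma ge0_integral_scale (c : R) (f : R -> \bar R) : c != 0%R ->
  measurable_fun [set: T] f -> (forall x, 0 <= f x) ->
  (`|c|%R)%:E * \int[mu]_x f (c * x)%R = \int[mu]_x f x.
Proof.
move=> c0 mf f0.
pose p : {measure set T -> \bar R} := ltac:(unshelve refine
  (pushforward mu (fun x : T => (c * x)%R : T) : {measure set T -> \bar R});
  exact: measurable_scale).
pose m : {measure set T -> \bar R} := mscale (NngNum (normr_ge0 c)) p.
transitivity (\int[m]_x f x).
  rewrite ge0_integral_mscale//= /p ge0_integral_pushforward//.
  exact: measurable_scale.
apply: eq_measure_integral => A mA _; apply/esym/lebesgue_measure_unique => //.
move=> _ [[a b]/= ab] <-.
rewrite /m /mscale/= /pushforward preimage_scale_ocitv//.
have [cp|cn] := boolP (0 < c)%R.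
- rewrite !lebesgue_measure_itv/= !lte_fin ltr_pM2l ?invr_gt0//.
  case: ifPn => _; last by rewrite mule0.
  by rewrite -!EFinB -EFinM gtr0_norm// -mulrBr mulrA divff// mul1r.
- have {}cn : (c < 0)%R by rewrite lt_neqAle c0 leNgt.
  rewrite !lebesgue_measure_itv/= !lte_fin ltr_nM2l ?invr_lt0//.
  case: ifPn => _; last by rewrite mule0.
  by rewrite -!EFinB -EFinM ltr0_norm// -mulrBr mulrA mulNr divff// mulN1r opprB.
Qed.

(** Tonelli adds one scaled coordinate to a change of variables [phi] with Jacobian [k]. Applied
    twice, it goes from the line to the plane and then to the space. *)
Lemma ge0_integral_prod_scale d (S : measurableType d)
    (m : {sigma_finite_measure set S -> \bar R}) (phi : S -> S) (k c : R) :
  measurable_fun setT phi -> (0 <= k)%R -> c != 0%R ->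
  (forall g : S -> \bar R, measurable_fun setT g -> (forall x, 0 <= g x) ->
    k%:E * \int[m]_x g (phi x) = \int[m]_x g x) ->
  forall f : S * T -> \bar R, measurable_fun setT f -> (forall p, 0 <= f p) ->
  (k * `|c|)%:E * \int[m \x mu]_p f (phi p.1, c * p.2)%R
  = \int[m \x mu]_p f p.
Proof.
move=> mphi k0 c0 mE f mf f0.
have mD : measurable_fun setT (fun p : S * T => (phi p.1, c * p.2 : T)%R).
  apply: measurable_fun_pair.
    exact: (measurableT_comp mphi measurable_fst).
  exact: (measurableT_comp (measurable_scale c) measurable_snd).
rewrite (@fubini_tonelli1 _ _ _ _ _ m mu (fun p => f (phi p.1, c * p.2)%R))//=;
  last exact: measurableT_comp.
rewrite (@fubini_tonelli1 _ _ _ _ _ m mu f)// /fubini_F/=.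
rewrite EFinM -muleA -ge0_integralZl//; last 2 first.
- have := @measurable_fun_fubini_tonelli_F _ _ _ _ _ mu
    (fun p => f (phi p.1, c * p.2)%R).
  by apply => //; exact: measurableT_comp.
- by move=> x _; exact: integral_ge0.
under [in LHS]eq_integral => x _.
  rewrite (@ge0_integral_scale c (fun y => f (phi x, y)))//; last first.
    exact: measurableT_comp.
  over.
rewrite (mE (fun x => \int[mu]_y f (x, y)))//.
- exact: (@measurable_fun_fubini_tonelli_F _ _ _ _ _ mu f).
- by move=> x; exact: integral_ge0.
Qed.

Lemma ge0_integral_dilate (s : R) (f : R * R * R -> \bar R) : s != 0%R ->
  measurable_fun [set: T * T * T] f -> (forall p, 0 <= f p) ->
  (s ^+ 4)%:E * \int[lebesgue3]_p f (s * p.1.1, s * p.1.2, s ^+ 2 * p.2)%R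
  = \int[lebesgue3]_p f p.
Proof.
move=> s0 mf f0.
have -> : (s ^+ 4 = (`|s| * `|s|) * `|s ^+ 2|)%R.
  by rewrite -!normrM -expr2 -exprD ger0_norm ?exprn_even_ge0.
have ms2 : measurable_fun setT
    (fun q : T * T => ((s * q.1)%R : T, (s * q.2)%R : T)).
  apply: measurable_fun_pair;
    [exact: (measurableT_comp (measurable_scale s) measurable_fst)
    |exact: (measurableT_comp (measurable_scale s) measurable_snd)].
have E2 := @ge0_integral_prod_scale _ T mu (fun x => s * x)%R `|s|%R s
  (measurable_scale s) (normr_ge0 s) s0
  (fun g mg g0 => ge0_integral_scale s0 mg g0).
exact: (@ge0_integral_prod_scale _ (T * T)%type lebesgue2
  (fun q => (s * q.1, s * q.2)%R) (`|s| * `|s|)%R (s ^+ 2)%R ms2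
  (mulr_ge0 (normr_ge0 s) (normr_ge0 s)) (expf_neq0 2 s0) E2 f mf f0).
Qed.

End LebesgueScaling.

Section Coordinates.
Context {R : realType}.
Local Notation T := (measurableTypeR R).
Local Notation H := (T * T * T)%type.

Lemma measurable_coord1 : measurable_fun [set: H] (fun p => p.1.1 : R).
Proof. exact: (measurableT_comp measurable_fst measurable_fst). Qed.

Lemma measurable_coord2 : measurable_fun [set: H] (fun p => p.1.2 : R).
Proof. exact: (measurableT_comp measurable_snd measurable_fst). Qed.

Lemma measurable_coord3 : measurable_fun [set: H] (fun p => p.2 : R).
Proof. exact: measurable_snd. Qed.

End Coordinates.

Ltac solve_measurable := repeat first
  [ exact: measurable_coord1 | exact: measurable_coord2
  | exact: measurable_coord3 | exact: measurable_cst
  | apply: measurable_funX | apply: measurable_funB | apply: measurable_funD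
  | apply: measurable_funM ].

Local Close Scope ereal_scope.

(** * The Koranyi norm under dilations, and measurability *)

Section Koranyi.
Context {R : realType}.
Local Notation mu := (@lebesgue_measure R).
Local Notation T := (measurableTypeR R).
Local Notation H := (T * T * T)%type.
Implicit Types (p : R * R * R) (r s : R).

(** The fourth power of the Koranyi norm: a polynomial, so that comparisons of norms become
    polynomial inequalities. *)
Definition koranyi4 p : R := (p.1.1 ^+ 2 + p.1.2 ^+ 2) ^+ 2 + p.2 ^+ 2.

Definition dilate s p : R * R * R := (s * p.1.1, s * p.1.2, s ^+ 2 * p.2).

Lemma koranyi4_ge0 p : 0 <= koranyi4 p.
Proof. by rewrite addr_ge0// sqr_ge0. Qed.

Lemma koranyi_ge0 p : 0 <= koranyi p.
Proof. by case: p => [[x y] t]; exact: powR_ge0. Qed.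

Lemma koranyiE p : koranyi p = koranyi4 p `^ 4^-1.
Proof. by case: p => [[x y] t]. Qed.

Lemma koranyiX4 p : koranyi p ^+ 4 = koranyi4 p.
Proof.
rewrite koranyiE -powR_mulrn ?powR_ge0// -powRrM mulVf ?pnatr_eq0//.
by rewrite powRr1// koranyi4_ge0.
Qed.

Lemma koranyi_dilate s p : koranyi (dilate s p) = `|s| * koranyi p.
Proof.
apply/eqP; rewrite -(@eqrXn2 _ 4)//; last 2 first.
- exact: koranyi_ge0.
- by rewrite mulr_ge0// koranyi_ge0.
rewrite exprMn !koranyiX4 -normrX ger0_norm ?exprn_even_ge0//.
by apply/eqP; rewrite /koranyi4 /dilate/=; ring.
Qed.

Lemma koranyi_ltP r p : 0 < r -> (koranyi p < r) = (koranyi4 p < r ^+ 4).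
Proof. by move=> r0; rewrite -koranyiX4 ltr_pXn2r// nnegrE ?koranyi_ge0// ltW. Qed.

Lemma u_ex_dilateN p : u_ex (dilate (-1) p) = - u_ex p.
Proof. by case: p => [[x y] t]; rewrite /u_ex /dilate/=; ring. Qed.

Lemma gradsq_dilateN p : gradsq (dilate (-1) p) = gradsq p.
Proof. by rewrite /gradsq /Xu /Yu /dilate/=; ring. Qed.

Lemma measurable_koranyi4 : measurable_fun [set: H] koranyi4.
Proof. rewrite /koranyi4; solve_measurable. Qed.

Lemma measurable_koranyi : measurable_fun [set: H] koranyi.
Proof.
rewrite (_ : koranyi = (@powR R ^~ 4^-1) \o koranyi4).
  exact: (measurableT_comp (measurable_powR 4^-1) measurable_koranyi4).
by apply/funext => p; rewrite koranyiE.
Qed.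

Lemma u_exE : u_ex = fun p : H => p.1.1 - 3 * p.1.2 * p.2 - 2 * p.1.1 ^+ 3 :> R.
Proof. by apply/funext => -[[x y] t]. Qed.

Lemma measurable_u_ex : measurable_fun [set: H] u_ex.
Proof. rewrite u_exE; solve_measurable. Qed.

Lemma measurable_gradsq : measurable_fun [set: H] gradsq.
Proof. rewrite /gradsq /Xu /Yu; solve_measurable. Qed.

Lemma measurable_koranyi_ball r :
  measurable (koranyi_ball r : set H).
Proof.
rewrite /koranyi_ball -[X in measurable X]setTI.
rewrite (_ : [set p | _] = koranyi @^-1` `]-oo, r[); first exact: measurable_koranyi.
by apply/seteqP; split => p; rewrite /= in_itv.
Qed.

End Koranyi.

Local Open Scope ereal_scope.

(** * Energies of the two parts *)

Section Energies.
Context {R : realType}.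
Local Notation mu := (@lebesgue_measure R).
Local Notation T := (measurableTypeR R).
Local Notation H := (T * T * T)%type.
Implicit Types (p : R * R * R) (r s : R).

Lemma measurable_dilate s : measurable_fun [set: H] (dilate s : H -> H).
Proof.
apply: measurable_fun_pair; first apply: measurable_fun_pair.
- exact: (measurableT_comp (measurable_scale s) measurable_coord1).
- exact: (measurableT_comp (measurable_scale s) measurable_coord2).
- exact: (measurableT_comp (measurable_scale (s ^+ 2)) measurable_coord3).
Qed.

(** This is the change of variables for [f] extended by 0 outside [D]. *)
Lemma ge0_integral_dilate_set s (D : set H) (f : R * R * R -> \bar R) :
  s != 0%R -> measurable D -> measurable_fun [set: H] f ->
  (forall p, 0 <= f p) ->
  (s ^+ 4)%:E * \int[lebesgue3]_(p in dilate s @^-1` D) f (dilate s p)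
  = \int[lebesgue3]_(p in D) f p.
Proof.
move=> s0 mD mf f0; rewrite [RHS]integral_mkcond [in LHS]integral_mkcond.
rewrite -[RHS](@ge0_integral_dilate _ s)//.
- apply/(measurable_restrictT _ mD); exact: measurable_funTS.
- by move=> p; exact: erestrict_ge0.
Qed.

Lemma line_null : lebesgue2 [set q : R * R | q.2 = 0%R] = 0.
Proof.
rewrite /lebesgue2 /product_measure1 integral0_eq// => x _ /=.
rewrite (_ : xsection _ _ = [set 0%R]) ?lebesgue_measure_set1//.
by apply/seteqP; split => y; rewrite /xsection/= inE.
Qed.

(** For y nonzero, u = 0 is affine in t with the single root (x - 2 x^3) / (3 y), so the slice over
    (x, y) is null. The remaining base points, with y = 0, form a null set of the plane. *)
Lemma u_ex_zero_null : lebesgue3 [set p : R * R * R | u_ex p = 0%R] = 0.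
Proof.
pose N : set H := [set p | u_ex p = 0%R].
have mN : measurable N.
  rewrite /N -[X in measurable X]setTI; exact: (measurable_u_ex _ (measurable_set1 0%R)).
have mL : measurable ([set q : T * T | q.2 = 0%R]).
  rewrite (_ : [set q | _] = setT `*` [set 0%R]); first exact: measurableX.
  by apply/seteqP; split => q //= -[].
rewrite -/N /lebesgue3 {1}/product_measure1.
rewrite -[X in (\int[X]_x _)%E]/(@lebesgue2 R).
rewrite (ge0_negligible_integral mL)//; last 2 first.
- exact: measurable_fun_xsection.
- exact: line_null.
rewrite integral0_eq// => -[x y] [_ /= /eqP y0].
apply: (@subset_measure0 _ _ _ mu _ [set ((x - 2 * x ^+ 3) / (3 * y))%R]) => //.
- exact: measurable_xsection.
- move=> t; rewrite /xsection/= inE /N/= => ut.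
  rewrite (_ : (x - 2 * x ^+ 3 = t * (3 * y))%R) ?mulfK//.
    by rewrite mulf_neq0// pnatr_eq0.
  by apply/eqP; rewrite -subr_eq0 -ut; apply/eqP; ring.
- exact: lebesgue_measure_set1.
Qed.

Definition density p : R := (gradsq p / koranyi p ^+ 2)%R.

Lemma density_ge0 p : (0 <= density p)%R.
Proof. by rewrite divr_ge0 ?sqr_ge0// addr_ge0// sqr_ge0. Qed.

Lemma measurable_koranyiV2 : measurable_fun [set: H] (fun p => (koranyi p ^+ 2)^-1 : R)%R.
Proof.
rewrite (_ : (fun _ => _) = (@powR R ^~ (- 2)%R) \o (koranyi : H -> R)).
  exact: (measurableT_comp (measurable_powR (- 2)%R) measurable_koranyi).
by apply/funext => p /=; rewrite powRN powR_mulrn ?koranyi_ge0.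
Qed.

Lemma measurable_density : measurable_fun [set: H] density.
Proof. exact: (measurable_funM measurable_gradsq measurable_koranyiV2). Qed.

Lemma measurable_EFin_density :
  measurable_fun [set: H] (fun p => (density p)%:E).
Proof. by apply/measurable_EFinP; exact: measurable_density. Qed.

Definition pos_part_ball r : set H := koranyi_ball r `&` [set p | 0 < u_ex p]%R.
Definition neg_part_ball r : set H := koranyi_ball r `&` [set p | u_ex p < 0]%R.

Lemma weighted_energy_pos r : weighted_energy (u_ex^\+)%R r =
  \int[lebesgue3]_(p in pos_part_ball r) (density p)%:E.
Proof.
rewrite /weighted_energy /pos_part_ball integral_mkcondr.
apply: eq_integral => p _; rewrite patchE sqnorm2_hgrad_pos.
case: ifPn => up; first by rewrite mem_set.
by rewrite memNset// ?mul0r//; exact/negP.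
Qed.

Lemma weighted_energy_neg r : weighted_energy (u_ex^\-)%R r =
  \int[lebesgue3]_(p in neg_part_ball r) (density p)%:E.
Proof.
rewrite /weighted_energy /neg_part_ball integral_mkcondr.
apply: eq_integral => p _; rewrite patchE sqnorm2_hgrad_neg.
case: ifPn => up; first by rewrite mem_set.
by rewrite memNset// ?mul0r//; exact/negP.
Qed.

Lemma measurable_pos_part_ball r : measurable (pos_part_ball r).
Proof.
apply: measurableI; first exact: measurable_koranyi_ball.
rewrite -[X in measurable X]setTI (_ : [set p | _] = u_ex @^-1` `]0%R, +oo[).
  exact: measurable_u_ex.
by apply/seteqP; split => p; rewrite /= in_itv/= andbT.
Qed.

Lemma measurable_neg_part_ball r : measurable (neg_part_ball r).
Proof.
apply: measurableI; first exact: measurable_koranyi_ball.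
rewrite -[X in measurable X]setTI (_ : [set p | _] = u_ex @^-1` `]-oo, 0%R[).
  exact: measurable_u_ex.
by apply/seteqP; split => p; rewrite /= in_itv/=.
Qed.

(* The dilation of ratio -1 is (x,y,t) |-> (-x,-y,t). *)
Lemma weighted_energy_neg_pos r :
  weighted_energy (u_ex^\-)%R r = weighted_energy (u_ex^\+)%R r.
Proof.
rewrite weighted_energy_pos weighted_energy_neg.
rewrite -(@ge0_integral_dilate_set (-1)%R (pos_part_ball r)) ?oppr_eq0 ?oner_eq0//.
- rewrite -signr_odd/= expr0 mul1e.
  have -> : dilate (-1)%R @^-1` pos_part_ball r = neg_part_ball r.
    apply/funext => p; rewrite /preimage /pos_part_ball /neg_part_ball.
    rewrite /koranyi_ball /setI /mkset.
    by rewrite koranyi_dilate normrN1 mul1r u_ex_dilateN oppr_gt0.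
  apply: eq_integral => p _.
  by rewrite /density gradsq_dilateN koranyi_dilate normrN1 mul1r.
- exact: measurable_pos_part_ball.
- exact: measurable_EFin_density.
- by move=> p; rewrite lee_fin density_ge0.
Qed.

Definition total_energy r := \int[lebesgue3]_(p in koranyi_ball r) (density p)%:E.

(** Off the null set where u vanishes, the ball is the disjoint union of its positive and negative
    parts. *)
Lemma weighted_energyD r :
  weighted_energy (u_ex^\+)%R r + weighted_energy (u_ex^\-)%R r = total_energy r.
Proof.
pose N : set H := [set p | u_ex p = 0%R].
have mN : measurable N.
  rewrite /N -[X in measurable X]setTI; exact: (measurable_u_ex _ (measurable_set1 0%R)).
have md := measurable_EFin_density.
rewrite weighted_energy_pos weighted_energy_neg /total_energy.
rewrite (@ge0_negligible_integral _ _ _ (@lebesgue3 R) (koranyi_ball r) N)//; last 4 first.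
- exact: measurable_koranyi_ball.
- exact: measurable_funTS.
- by move=> p _; rewrite lee_fin density_ge0.
- exact: u_ex_zero_null.
rewrite -ge0_integral_setU//.
- congr (integral _ _ _); apply/seteqP; split => p.
    by move=> [[Bp up]|[Bp up]]; split=> // u0; move: up; rewrite /mkset u0 ltxx.
  by move=> [Bp /eqP]; rewrite neq_lt => /orP[up|up]; [right|left].
- exact: measurable_pos_part_ball.
- exact: measurable_neg_part_ball.
- exact: measurable_funTS.
- by move=> p _; rewrite lee_fin density_ge0.
- apply/disj_set2P; rewrite -subset0 => p [[_ /= up] [_ /=]].
  by rewrite ltNge (ltW up).
Qed.

End Energies.

(** * Integrability of the weight *)

Section UnitBall.
Context {R : realType}.
Local Notation mu := (@lebesgue_measure R).
Local Notation T := (measurableTypeR R).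
Local Notation H := (T * T * T)%type.
Implicit Types (p : R * R * R) (r s : R).

Definition box (a b a' b' a'' b'' : R) : set H :=
  `[a, b]%classic `*` `[a', b']%classic `*` `[a'', b'']%classic.

Lemma lebesgue3_box (a b a' b' a'' b'' : R) :
  (a <= b)%R -> (a' <= b')%R -> (a'' <= b'')%R ->
  lebesgue3 (box a b a' b' a'' b'') = ((b - a) * (b' - a') * (b'' - a''))%:E.
Proof.
move=> ab ab' ab''.
have itvE (c d : R) : (c <= d)%R -> mu `[c, d]%classic = (d - c)%:E.
  rewrite lebesgue_measure_itv/= lte_fin le_eqVlt => /orP[/eqP ->|->] //.
  by rewrite ltxx subrr.
transitivity (mu `[a, b]%classic * mu `[a', b']%classic * mu `[a'', b'']%classic).
  rewrite /box -[lebesgue3]/(lebesgue2 \x mu).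
  rewrite product_measure1E//; last exact: measurableX.
  by rewrite -[X in X (_ `*` _)]/(mu \x mu) product_measure1E.
by rewrite !itvE.
Qed.

Lemma measurable_box (a b a' b' a'' b'' : R) : measurable (box a b a' b' a'' b'').
Proof. by apply: measurableX => //; exact: measurableX. Qed.

(** In this ball (x^2 + y^2)^2 + t^2 < 16, so |x| and |y| are below 2 and |t| is below 4. *)
Lemma koranyi_ball2_fin : lebesgue3 (@koranyi_ball R 2) < +oo.
Proof.
apply: (@le_lt_trans _ _ (lebesgue3 (box (-2) 2 (-2) 2 (-4) 4))); last first.
  by rewrite lebesgue3_box ?ltry//; lra.
apply: le_measure; rewrite ?inE.
- exact: measurable_koranyi_ball.
- exact: measurable_box.
move=> [[x y] t]; rewrite /koranyi_ball /mkset koranyi_ltP// /koranyi4/= => h.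
have x2 : (0 <= x ^+ 2)%R by exact: sqr_ge0.
have y2 : (0 <= y ^+ 2)%R by exact: sqr_ge0.
have t2 : (0 <= t ^+ 2)%R by exact: sqr_ge0.
have rho : (x ^+ 2 + y ^+ 2 < 4)%R by nra.
by split; [split|] => /=; rewrite in_itv/=; apply/andP; split; nra.
Qed.

(** The weight truncated at height 4^n. Base 4 matches the dilation by 1/2, which multiplies the
    weight by 4 and so carries one truncation level exactly to the next. *)
Definition cutoff n p : R := Num.min (koranyi p ^+ 2)^-1%R (4 ^+ n)%R.

Lemma cutoff_ge0 n p : (0 <= cutoff n p)%R.
Proof. by rewrite le_min invr_ge0 sqr_ge0 exprn_ge0. Qed.

Lemma measurable_cutoff n : measurable_fun [set: H] (fun p => (cutoff n p)%:E).
Proof.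
apply/measurable_EFinP; apply: measurable_minr => //.
exact: measurable_koranyiV2.
Qed.

Lemma cutoff_dilate n p : cutoff n.+1 (dilate 2^-1 p) = (4 * cutoff n p)%R.
Proof.
rewrite /cutoff koranyi_dilate exprMn invfM minr_pMr// -exprS; congr Num.min.
by congr (_ * _)%R; rewrite real_normK ?num_real// -exprVn invrK -natrX.
Qed.

Lemma preimage_dilate_ball s r : (0 < s)%R ->
  dilate s @^-1` koranyi_ball r = @koranyi_ball R (s^-1 * r).
Proof.
move=> s0; apply/funext => p; rewrite /preimage /koranyi_ball /mkset.
by rewrite koranyi_dilate gtr0_norm// ltr_pdivlMl.
Qed.

(* Dilating by 1/2, the integrals I_n over the unit ball satisfy
   I_(n+1) <= (I_n + V) / 4 with V the volume of the ball of radius 2. *)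
Lemma integral_cutoff_le n :
  \int[lebesgue3]_(p in koranyi_ball 1) (cutoff n p)%:E <=
  lebesgue3 (@koranyi_ball R 2).
Proof.
have mB r := @measurable_koranyi_ball R r.
have B12 : koranyi_ball 1 `<=` @koranyi_ball R 2.
  by move=> p; rewrite /koranyi_ball /mkset => /lt_trans; apply; lra.
elim: n => [|n IHn].
  apply: (@le_trans _ _ (\int[lebesgue3]_(p in @koranyi_ball R 1) 1)).
    apply: ge0_le_integral => //.
    - by move=> p _; rewrite lee_fin cutoff_ge0.
    - by apply: measurable_funTS; exact: measurable_cutoff.
    - by move=> p _; rewrite lee_fin /cutoff expr0 ge_min lexx orbT.
  by rewrite integral_cst// mul1e; apply: le_measure; rewrite ?inE.
rewrite -(@ge0_integral_dilate_set _ 2^-1)//; last 2 first.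
- exact: measurable_cutoff.
- by move=> p; rewrite lee_fin cutoff_ge0.
rewrite preimage_dilate_ball// invrK mulr1.
under eq_integral do rewrite cutoff_dilate EFinM.
rewrite ge0_integralZl_EFin//; last 2 first.
- by move=> p _; rewrite lee_fin cutoff_ge0.
- by apply: measurable_funTS; exact: measurable_cutoff.
rewrite -(setDUK B12) ge0_integral_setU//; last 4 first.
- exact: measurableD.
- by apply: measurable_funTS; exact: measurable_cutoff.
- by move=> p _; rewrite lee_fin cutoff_ge0.
- by rewrite disj_set2E setDIK.
rewrite (setDUK B12).
(* On the shell the norm is at least 1, so the weight is at most 1 and the integral is at most the
   volume. *)
have V2 : \int[lebesgue3]_(p in koranyi_ball 2 `\` koranyi_ball 1) (cutoff n p)%:E
    <= lebesgue3 (@koranyi_ball R 2).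
  apply: (@le_trans _ _ (\int[lebesgue3]_(p in @koranyi_ball R 2 `\` koranyi_ball 1) 1)).
    apply: ge0_le_integral => //.
    - exact: measurableD.
    - by move=> p _; rewrite lee_fin cutoff_ge0.
    - by apply: measurable_funTS; exact: measurable_cutoff.
    - move=> p [_ /negP]; rewrite -leNgt => k1.
      by rewrite lee_fin /cutoff ge_min invf_le1 ?exprn_ege1 ?exprn_gt0 ?(lt_le_trans _ k1).
  rewrite integral_cst ?mul1e; last exact: measurableD.
  by apply: le_measure; rewrite ?inE//; exact: measurableD.
(* By induction both pieces are at most V; the factor is 4 / 16, the Jacobian times the growth of
   the weight, so the total is at most V / 2. Finiteness of V then permits real arithmetic. *)
apply: (@le_trans _ _ ((2^-1 ^+ 4)%:E * (4%:E *
    (lebesgue3 (@koranyi_ball R 2) + lebesgue3 (@koranyi_ball R 2))))).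
  by rewrite !lee_pmul2l//; exact: leeD.
have /fineK <- : lebesgue3 (@koranyi_ball R 2) \is a fin_num.
  by rewrite ge0_fin_numE// koranyi_ball2_fin.
have v0 : (0 <= fine (lebesgue3 (@koranyi_ball R 2)))%R by exact: fine_ge0.
by rewrite -EFinD -!EFinM lee_fin; lra.
Qed.

(** The truncated weights increase to the weight and their integrals are bounded uniformly in n;
    monotone convergence concludes. *)
Lemma integral_koranyiV2_fin :
  \int[lebesgue3]_(p in @koranyi_ball R 1) ((koranyi p ^+ 2)^-1%R)%:E < +oo.
Proof.
apply: le_lt_trans koranyi_ball2_fin.
have mB := @measurable_koranyi_ball R 1.
have cvc p : (cutoff n p)%:E @[n --> \oo] --> ((koranyi p ^+ 2)^-1%R)%:E.
  apply: cvg_near_cst.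
  (* The inverse is a real number at every point, with value 0 at the origin by convention, so the
     truncation is eventually inactive everywhere. *)
  have [n hn] : exists n, ((koranyi p ^+ 2)^-1 <= 4 ^+ n :> R)%R.
    exists (Num.bound (koranyi p ^+ 2)^-1)%R; apply: ltW.
    apply: (lt_le_trans (upper_nthrootP (leqnn _))).
    by rewrite lerXn2r ?nnegrE// ler_nat.
  exists n => // m /= nm; apply/eqP; rewrite eqe /cutoff; apply/eqP/min_idPl.
  by rewrite (le_trans hn)// ler_eXn2l// ltr1n.
rewrite (_ : \int[_]_(_ in _) _ = limn (fun n =>
  \int[lebesgue3]_(p in @koranyi_ball R 1) (cutoff n p)%:E)); last first.
  rewrite -monotone_convergence//.
  - by apply: eq_integral => p _; apply/esym/cvg_lim.
  - by move=> n; by apply: measurable_funTS; exact: measurable_cutoff.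
  - by move=> n p _; rewrite lee_fin cutoff_ge0.
  - move=> p _ m n mn; rewrite lee_fin /cutoff le_min !ge_min lexx/=.
    by rewrite ler_weXn2l ?orbT// ler1n.
apply: lime_le; last by apply: nearW => n; exact: integral_cutoff_le.
apply: ereal_nondecreasing_is_cvgn => m n mn; apply: ge0_le_integral => //.
- by move=> p _; rewrite lee_fin cutoff_ge0.
- by apply: measurable_funTS; exact: measurable_cutoff.
- by apply: measurable_funTS; exact: measurable_cutoff.
- move=> p _; rewrite lee_fin /cutoff le_min !ge_min lexx/=.
  by rewrite ler_weXn2l ?orbT// ler1n.
Qed.

End UnitBall.

(** * Expansion of the energy *)

Section Expansion.
Context {R : realType}.
Local Notation T := (measurableTypeR R).
Local Notation H := (T * T * T)%type.
Implicit Types (p : R * R * R) (r s : R) (g h : R * R * R -> R).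

(** The moments of 1, [rho2] and [quartic] are the coefficients a, b and c of the expansion in r. *)
Definition moment g :=
  \int[lebesgue3]_(p in @koranyi_ball R 1) (g p / koranyi p ^+ 2)%:E.

Lemma measurable_moment g : measurable_fun [set: H] g ->
  measurable_fun [set: H] (fun p => (g p / koranyi p ^+ 2)%:E).
Proof.
move=> mg; apply/measurable_EFinP.
exact: (measurable_funM mg measurable_koranyiV2).
Qed.

Lemma moment_fin g (C : R) : measurable_fun [set: H] g ->
  (forall p, 0 <= g p)%R -> (forall p, koranyi p < 1 -> g p <= C)%R ->
  exists2 m : R, (0 <= m)%R & moment g = m%:E.
Proof.
move=> mg g0 gC.
(* The origin lies in the unit ball, so [C] bounds a nonnegative value there. *)
have C0 : (0 <= C)%R.
  apply: (le_trans (g0 0%R)); apply: gC.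
  by rewrite koranyi_ltP// /koranyi4/= !expr0n/= !addr0 expr0n/= exprn_gt0.
have gk0 p : (0 <= g p / koranyi p ^+ 2)%R by rewrite divr_ge0 ?sqr_ge0.
have m0 : 0 <= moment g by apply: integral_ge0 => p _; rewrite lee_fin.
exists (fine (moment g)); first exact: fine_ge0.
rewrite fineK// ge0_fin_numE//.
apply: (@le_lt_trans _ _ (C%:E * \int[lebesgue3]_(p in @koranyi_ball R 1)
    ((koranyi p ^+ 2)^-1%R)%:E)); last first.
  by rewrite lte_mul_pinfty// ?lee_fin// integral_koranyiV2_fin.
have mV : measurable_fun [set: H] (fun p => ((koranyi p ^+ 2)^-1)%:E : \bar R).
  by apply/measurable_EFinP; exact: measurable_koranyiV2.
have mB := @measurable_koranyi_ball R 1.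
rewrite -ge0_integralZl_EFin//; last 2 first.
- by move=> p _; rewrite lee_fin invr_ge0 sqr_ge0.
- exact: measurable_funTS.
apply: ge0_le_integral => //.
- by move=> p _; rewrite lee_fin.
- by apply: measurable_funTS; exact: measurable_moment.
- by apply: measurable_funeM; exact: measurable_funTS.
- by move=> p kp; rewrite -EFinM lee_fin ler_wpM2r ?invr_ge0 ?sqr_ge0// gC.
Qed.

Definition rho2 p : R := (p.1.1 ^+ 2 + p.1.2 ^+ 2)%R.
(** The coefficient of r^4 in [gradsq (dilate r p)]. *)
Definition quartic p : R := (36 * rho2 p ^+ 2 + Yu p ^+ 2)%R.

(** The negative r^2 term stands on the left, so both sides are sums of nonnegative functions and
    integrate termwise in the extended reals. *)
Lemma gradsq_dilateE r p : (gradsq (dilate r p) + 12 * r ^+ 2 * rho2 p =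
  1 + r ^+ 4 * quartic p)%R.
Proof. by rewrite /gradsq /quartic /Xu /Yu /rho2 /dilate/=; ring. Qed.

Lemma measurable_rho2 : measurable_fun [set: H] rho2.
Proof.
rewrite /rho2; solve_measurable.
Qed.

Lemma measurable_Yu : measurable_fun [set: H] Yu.
Proof.
rewrite /Yu; solve_measurable.
Qed.

Lemma measurable_quartic : measurable_fun [set: H] quartic.
Proof.
rewrite /quartic; apply: measurable_funD.
  apply: measurable_funM; first exact: measurable_cst.
  by apply: measurable_funX; exact: measurable_rho2.
by apply: measurable_funX; exact: measurable_Yu.
Qed.

Lemma rho2_ge0 p : (0 <= rho2 p)%R.
Proof. by rewrite addr_ge0 ?sqr_ge0. Qed.

Lemma quartic_ge0 p : (0 <= quartic p)%R.
Proof. by rewrite /quartic addr_ge0 ?sqr_ge0// mulr_ge0 ?sqr_ge0. Qed.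

Lemma rho2_le1 p : (koranyi p < 1)%R -> (rho2 p <= 1)%R.
Proof.
rewrite koranyi_ltP// /koranyi4 -/(rho2 p) expr1n => h.
have := rho2_ge0 p; have := sqr_ge0 p.2; nra.
Qed.

(** The constant is 36 + 72 + 18, from [rho2], (x y)^2 and t^2 each at most 1 and (A - B)^2 <= 2 A^2
    + 2 B^2 with A = 6 x y, B = 3 t. *)
Lemma quartic_le p : (koranyi p < 1)%R -> (quartic p <= 126)%R.
Proof.
move=> kp; have := rho2_le1 kp; move: kp.
rewrite koranyi_ltP// expr1n /quartic /koranyi4 /Yu /rho2.
case: p => [[x y] t]/= h1 h2.
have x2 : (0 <= x ^+ 2)%R by exact: sqr_ge0.
have y2 : (0 <= y ^+ 2)%R by exact: sqr_ge0.
have t2 : (0 <= t ^+ 2)%R by exact: sqr_ge0.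
have r4 : ((x ^+ 2 + y ^+ 2) ^+ 2 <= 1)%R by nra.
have t1 : (t ^+ 2 <= 1)%R by nra.
have xy : ((x * y) ^+ 2 <= 1)%R by nra.
have sq : ((6 * x * y - 3 * t) ^+ 2 <= 72 * (x * y) ^+ 2 + 18 * t ^+ 2)%R.
  by have := sqr_ge0 (6 * (x * y) + 3 * t)%R; lra.
lra.
Qed.

(** On a box inside the unit ball with x >= 1/4, [rho2] is at least 1/16, and dividing by a positive
    squared norm below 1 only increases it. The box has positive volume. *)
Lemma moment_rho2_gt0 : 0 < moment rho2.
Proof.
have mB := @measurable_koranyi_ball R 1.
pose Q := @box R 4^-1 2^-1 0 4^-1 0 4^-1.
have mQ : measurable Q by exact: measurable_box.
have QB : Q `<=` koranyi_ball 1.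
  move=> [[x y] t] [[/= ]]; rewrite !in_itv/= => /andP[x1 x2] /andP[y1 y2] /andP[t1 t2].
  rewrite /koranyi_ball /mkset koranyi_ltP// /koranyi4/= expr1n.
  have : (x ^+ 2 <= 4^-1)%R by nra.
  have : (y ^+ 2 <= 16^-1)%R by nra.
  have : (t ^+ 2 <= 16^-1)%R by nra.
  have x2' : (0 <= x ^+ 2)%R by exact: sqr_ge0.
  have y2' : (0 <= y ^+ 2)%R by exact: sqr_ge0.
  nra.
have mm : measurable_fun [set: H] (fun p => (rho2 p / koranyi p ^+ 2)%:E).
  by apply: measurable_moment; exact: measurable_rho2.
have r0 p : 0 <= (rho2 p / koranyi p ^+ 2)%:E.
  by rewrite lee_fin divr_ge0 ?sqr_ge0// rho2_ge0.
apply: (@lt_le_trans _ _ (\int[lebesgue3]_(p in Q) (16^-1)%:E)).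
  rewrite integral_cst// -[X in _ * X]/(lebesgue3 Q) lebesgue3_box; [|lra|lra|lra].
  by rewrite -EFinM lte_fin; lra.
apply: (@le_trans _ _ (\int[lebesgue3]_(p in Q) (rho2 p / koranyi p ^+ 2)%:E)).
  apply: ge0_le_integral => //.
  - exact: measurable_funTS.
  - move=> p Qp; rewrite lee_fin.
    have k1 : (koranyi p < 1)%R by exact: QB.
    have rp : (16^-1 <= rho2 p)%R.
      case: p Qp {k1} => [[x y] t] [[/=]]; rewrite !in_itv/= => /andP[x1 x2] _ _.
      by rewrite /rho2/=; have := sqr_ge0 y; nra.
    have k0 : (0 < koranyi p)%R.
      rewrite lt_neqAle koranyi_ge0 eq_sym andbT; apply/negP => /eqP k0.
      have := koranyiX4 p; rewrite k0 expr0n/= /koranyi4 -/(rho2 p) => h.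
      by have := sqr_ge0 p.2; nra.
    rewrite ler_pdivlMr ?exprn_gt0//; apply: le_trans rp.
    by rewrite ler_piMr// expr_le1 ?koranyi_ge0// ltW.
by apply: ge0_subset_integral => //; exact: measurable_funTS.
Qed.

(** The Jacobian contributes r^4 and the weight r^-2. *)
Lemma total_energyE r : (0 < r)%R ->
  total_energy r = (r ^+ 2)%:E * moment (gradsq \o dilate r).
Proof.
move=> r0; have rn0 : r != 0%R by rewrite gt_eqF.
have mB := @measurable_koranyi_ball R 1.
have gk0 p : (0 <= gradsq (dilate r p) / koranyi p ^+ 2)%R.
  by rewrite divr_ge0 ?sqr_ge0// addr_ge0 ?sqr_ge0.
rewrite /total_energy -(@ge0_integral_dilate_set _ r)//; last 3 first.
- exact: measurable_koranyi_ball.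
- exact: measurable_EFin_density.
- by move=> p; rewrite lee_fin density_ge0.
rewrite preimage_dilate_ball// mulVf//.
have E p : density (dilate r p) =
    (r ^- 2 * (gradsq (dilate r p) / koranyi p ^+ 2))%R.
  by rewrite /density koranyi_dilate gtr0_norm// exprMn invfM mulrCA.
under eq_integral do rewrite E EFinM.
rewrite ge0_integralZl_EFin//; last 3 first.
- by move=> p _; rewrite lee_fin.
- apply: measurable_funTS; apply: measurable_moment.
  exact: (measurableT_comp measurable_gradsq (measurable_dilate r)).
- by rewrite invr_ge0 sqr_ge0.
rewrite muleA -EFinM; congr (_%:E * _).
by rewrite (exprD r 2 2) mulfK// expf_neq0.
Qed.

Lemma momentD g h : measurable_fun [set: H] g -> measurable_fun [set: H] h ->
  (forall p, 0 <= g p)%R -> (forall p, 0 <= h p)%R ->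
  moment (fun p => g p + h p)%R = moment g + moment h.
Proof.
move=> mg mh g0 h0; rewrite -ge0_integralD//.
- by apply: eq_integral => p _; rewrite mulrDl EFinD.
- exact: measurable_koranyi_ball.
- by move=> p _; rewrite lee_fin divr_ge0 ?sqr_ge0.
- by apply: measurable_funTS; exact: measurable_moment.
- by move=> p _; rewrite lee_fin divr_ge0 ?sqr_ge0.
- by apply: measurable_funTS; exact: measurable_moment.
Qed.

Lemma momentZ (c : R) g : (0 <= c)%R -> measurable_fun [set: H] g ->
  (forall p, 0 <= g p)%R -> moment (fun p => c * g p)%R = c%:E * moment g.
Proof.
move=> c0 mg g0; rewrite -ge0_integralZl_EFin//.
- by apply: eq_integral => p _; rewrite -mulrA EFinM.
- exact: measurable_koranyi_ball.
- by move=> p _; rewrite lee_fin divr_ge0 ?sqr_ge0.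
- by apply: measurable_funTS; exact: measurable_moment.
Qed.

Lemma moment_gradsq_dilate : exists a b c : R, [/\ (0 < b)%R, (0 <= c)%R &
  forall r, moment (gradsq \o dilate r) = (a - 12 * r ^+ 2 * b + r ^+ 4 * c)%:E].
Proof.
have [a a0 aE] := @moment_fin (fun=> 1%R) 1%R (measurable_cst _)
  (fun=> ler01) (fun _ _ => lexx _).
have [b _ bE] := moment_fin measurable_rho2 rho2_ge0 rho2_le1.
have [c c0 cE] := moment_fin measurable_quartic quartic_ge0 quartic_le.
exists a, b, c; split=> // [|r]; first by rewrite -lte_fin -bE moment_rho2_gt0.
have mg : measurable_fun [set: H] (gradsq \o dilate r).
  exact: (measurableT_comp measurable_gradsq (measurable_dilate r)).
have g0 p : (0 <= (gradsq \o dilate r) p)%R by rewrite addr_ge0 ?sqr_ge0.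
have r2 : (0 <= 12 * r ^+ 2)%R by rewrite mulr_ge0 ?sqr_ge0.
have r4 : (0 <= r ^+ 4)%R by rewrite exprn_even_ge0.
have mr : measurable_fun [set: H] (fun p => 12 * r ^+ 2 * rho2 p)%R.
  by apply: measurable_funM; [exact: measurable_cst|exact: measurable_rho2].
have mq : measurable_fun [set: H] (fun p => r ^+ 4 * quartic p)%R.
  by apply: measurable_funM; [exact: measurable_cst|exact: measurable_quartic].
have : moment (gradsq \o dilate r) + (12 * r ^+ 2 * b)%:E = (a + r ^+ 4 * c)%:E.
  have <- : moment (fun p => 12 * r ^+ 2 * rho2 p)%R = (12 * r ^+ 2 * b)%:E.
    by rewrite (momentZ r2 measurable_rho2 rho2_ge0) bE.
  have <- : moment (fun p => 1 + r ^+ 4 * quartic p)%R = (a + r ^+ 4 * c)%:E.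
    rewrite momentD//; last by move=> p; rewrite mulr_ge0// quartic_ge0.
    by rewrite (momentZ r4 measurable_quartic quartic_ge0) aE cE.
  rewrite -momentD//; last by move=> p; rewrite mulr_ge0// rho2_ge0.
  by congr (moment _); apply/funext => p; exact: gradsq_dilateE.
(* A sum with a real term equals a real number, which excludes infinite values of the moment and
   allows subtraction. *)
case: (moment _) => [m| |]//= [] /(canRL (addrK _)) ->.
by congr (_%:E); ring.
Qed.

End Expansion.

Local Close Scope ereal_scope.
Local Close Scope classical_set_scope.

(** * Closed form of J and its monotonicity near 0 *)

(** The two energies are equal and add up to r^2 m, so each is real and equal to half of it. *)
Lemma weighted_energy_posE {R : realType} (r m : R) : 0 < r ->
  moment (gradsq \o dilate r) = m%:E ->
  weighted_energy (u_ex^\+) r = (r ^+ 2 * m / 2)%:E.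
Proof.
move=> r0 mE; have := weighted_energyD r.
rewrite weighted_energy_neg_pos total_energyE// mE.
case: (weighted_energy _ _) => [e| |]//= [] h.
by congr (_%:E); lra.
Qed.

Lemma heisJ_u_exE {R : realType} (r m : R) : 0 < r ->
  moment (gradsq \o dilate r) = m%:E -> heisJ u_ex r = (m ^+ 2 / 4)%:E.
Proof.
move=> r0 mE; rewrite /heisJ weighted_energy_neg_pos.
rewrite !(weighted_energy_posE r0 mE) -!EFinM; congr (_%:E).
by field; rewrite gt_eqF.
Qed.

Unset Implicit Arguments.
Set Strict Implicit.

Theorem theorem1p1 (R : realType) :
  (forall p : R * R * R, kohn_laplace u_ex p = 0) /\
  (exists r0 : R, 0 < r0 /\
    forall r1 r2 : R, 0 < r1 -> r1 < r2 -> r2 < r0 ->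
      (heisJ u_ex r2 < heisJ u_ex r1)%E).
Proof.
split; first exact: kohn_laplace_u_ex.
have [a [b [c [b0 c0 mE]]]] := @moment_gradsq_dilate R.
(* Below this radius r2^2 <= r2 and r2 (c + 1) < b, hence (r1^2 + r2^2) c <= 2 r2 c < 2 b < 12 b.
   Using c + 1 keeps the denominator positive when c = 0. *)
exists (Num.min 1 (b / (c + 1))); split.
  by rewrite lt_min ltr01 divr_gt0// ltr_wpDl.
move=> r1 r2 r1_gt0 r12; rewrite lt_min ltr_pdivlMr ?ltr_wpDl// => /andP[r2_lt1 r2b].
have r2_gt0 : 0 < r2 by exact: lt_trans r12.
rewrite (heisJ_u_exE r1_gt0 (mE _)) (heisJ_u_exE r2_gt0 (mE _)) lte_fin.
(* Nonnegativity of m, as the integral of a nonnegative function, reduces the comparison of the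
   squares to that of m(r2) and m(r1). *)
have m_ge0 r : 0 <= a - 12 * r ^+ 2 * b + r ^+ 4 * c.
  rewrite -lee_fin -mE; apply: integral_ge0 => p _.
  by rewrite lee_fin divr_ge0 ?sqr_ge0// addr_ge0 ?sqr_ge0.
rewrite ltr_pM2r ?invr_gt0// ltr_pXn2r ?nnegrE//.
(* The difference m(r1) - m(r2) is factored by r2^2 - r1^2; the choice of the radius makes the other
   factor positive. *)
have -> : a - 12 * r1 ^+ 2 * b + r1 ^+ 4 * c =
    (a - 12 * r2 ^+ 2 * b + r2 ^+ 4 * c) +
    (r2 ^+ 2 - r1 ^+ 2) * (12 * b - (r1 ^+ 2 + r2 ^+ 2) * c) by ring.
rewrite ltrDl mulr_gt0//; first by rewrite subr_gt0 ltr_pXn2r ?nnegrE// ltW.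
have : r2 ^+ 2 <= r2 by rewrite expr2 ler_piMl// ltW.
have : r1 ^+ 2 <= r2 ^+ 2 by rewrite ler_pXn2r ?nnegrE// ltW.
nra.
Qed.
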